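(* Let $n\ge 1$ be an integer. For all real $a<b$, every $\alpha\geq 0$ and every $r>0$, $$g_{\alpha}(ra,rb)\geq r\,g_{\alpha}(a,b)\quad\text{if and only if}\quad r\geq 1 .$$
   Context: For an integer $n\ge1$ and $\alpha\ge0$, let $$f_{\alpha,n}(x)=\frac{c}{(1+\alpha^2+x^2)^{(n+1)/2}},\qquad x\in\mathbb{R},$$ where $c=c(\alpha,n)>0$ is the normalizing constant making this a probability density on $\mathbb{R}$. For real $a<b$, $g_\alpha(a,b)=g_{\alpha,n}(a,b)$ is the unique real number with $\int_{-\infty}^{g_\alpha(a,b)}f_{\alpha,n}(t)\,dt=\int_a^b f_{\alpha,n}(t)\,dt$. *)

(* Defs.v *)
From Stdlib Require Import Reals.
From Coquelicot Require Import Coquelicot.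
Open Scope R_scope.

Definition kernel (alpha : R) (n : nat) (x : R) : R :=
  / Rpower (1 + alpha ^ 2 + x ^ 2) ((INR n + 1) / 2).

(* [iota P] is the unique real satisfying [P] whenever [exists! x, P x]
   (lemma [iota_correct]), and unspecified otherwise. For n >= 1 the kernel is
   positive, continuous and integrable over the line, so the description below
   is satisfied by exactly one real, and for a < b so is that of [g]. *)
Definition norm_const (alpha : R) (n : nat) : R :=
  iota (fun c : R => 0 < c /\
    is_RInt_gen (fun x => c * kernel alpha n x)
      (Rbar_locally m_infty) (Rbar_locally p_infty) 1).

Definition f (alpha : R) (n : nat) (x : R) : R :=
  norm_const alpha n * kernel alpha n x.

Definition g (alpha : R) (n : nat) (a b : R) : R :=
  iota (fun z : R =>
    is_RInt_gen (f alpha n) (Rbar_locally m_infty) (at_point z)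
      (RInt (f alpha n) a b)).

(* Main.v *)
(** Write [Phi] for the distribution function of the kernel [k], up to
    normalization, and [m] for its total mass, so that [Phi x + Phi (- x) = m].
    By this symmetry [Phi z = Phi b - Phi a] says that the points
    [x = a], [y = - b], [w = z] satisfy [Phi x + Phi y + Phi w = m], and the
    theorem amounts to [Phi (r x) + Phi (r y) + Phi (r w) < m] for [1 < r].
    If the three points are negative, this is monotonicity of [Phi].  Otherwise,
    say [0 <= w], so that [Phi x + Phi y = Phi (- w)].  The ratio
    [k (r t) / k t] is increasing on the negative axis, hence so is
    [Phi (r t) / Phi t], and therefore
    [Phi (r x) + Phi (r y) < Phi (- r w)].  The case [r < 1] follows by
    exchanging the roles of [(a, b)] and [(r a, r b)]. *)

Require Import Defs.
From Stdlib Require Import Reals Lra Psatz.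
From Coquelicot Require Import Coquelicot.
Open Scope R_scope.

(** * Monotone functions and improper integrals *)

Lemma derive_pos_increasing (F k : R -> R)
  (dF : forall x, is_derive F x (k x)) (k_pos : forall x, 0 < k x) (x y : R) :
  x < y -> F x < F y.
Proof.
  intros Hxy.
  exact (incr_function F m_infty p_infty k (fun t _ _ => dF t)
           (fun t _ _ => k_pos t) x y I Hxy I).
Qed.

Lemma is_RInt_gen_inj (Fa Fb : (R -> Prop) -> Prop) {FFa : ProperFilter' Fa}
  {FFb : ProperFilter' Fb} (h : R -> R) (l1 l2 : R) :
  is_RInt_gen h Fa Fb l1 -> is_RInt_gen h Fa Fb l2 -> l1 = l2.
Proof.
  intros H1 H2.
  rewrite <- (@is_RInt_gen_unique R_CompleteNormedModule _ _ _ _ h l1 H1).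
  exact (@is_RInt_gen_unique R_CompleteNormedModule _ _ _ _ h l2 H2).
Qed.

(** The limit is the infimum of [F] on the nonpositive axis, obtained as minus the supremum of
    [- F]. *)
Lemma nondecreasing_lim_m_infty (F : R -> R) (M : R)
  (F_incr : forall x y, x <= y -> F x <= F y)
  (F_bound : forall x, x <= 0 -> M <= F x) :
  exists l : R, is_lim F m_infty l.
Proof.
  destruct (completeness (fun y => exists x, x <= 0 /\ y = - F x)) as [L [HL1 HL2]].
  - exists (- M). intros y [x [Hx ->]]. specialize (F_bound x Hx). lra.
  - exists (- F 0), 0. split; lra.
  - exists (- L). apply is_lim_spec. intros eps.
    assert (Hx0 : exists x0, x0 <= 0 /\ F x0 < - L + eps).
    { apply Classical_Prop.NNPP. intros Hn.
      assert (HLe : L <= L - eps).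
      { apply HL2. intros y [x [Hx ->]].
        destruct (Rle_dec (- L + eps) (F x)) as [H|H]; [lra|].
        exfalso. apply Hn. exists x. lra. }
      destruct eps as [e He]; simpl in *; lra. }
    destruct Hx0 as [x0 [Hx0 HF]]. exists x0. intros x Hx.
    assert (H1 : - F x <= L) by (apply HL1; exists x; split; [lra|easy]).
    assert (H2 : F x <= F x0) by (apply F_incr; lra).
    apply Rabs_def1; destruct eps as [e He]; simpl in *; lra.
Qed.

(** * The kernel and its primitive *)

Lemma kernel_pos (alpha : R) (n : nat) (x : R) : 0 < kernel alpha n x.
Proof. apply Rinv_0_lt_compat, exp_pos. Qed.

Lemma kernel_even (alpha : R) (n : nat) (x : R) :
  kernel alpha n (- x) = kernel alpha n x.
Proof. unfold kernel. do 3 f_equal. ring. Qed.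

Lemma kernel_continuous (alpha : R) (n : nat) (x : R) :
  continuous (kernel alpha n) x.
Proof.
  apply (ex_derive_continuous (kernel alpha n)).
  unfold kernel, Rpower. auto_derive. repeat split.
  - nra.
  - apply Rgt_not_eq, exp_pos.
Qed.

(** The base is at least 1 and, as [1 <= n], so is the exponent. Comparison with the derivative of
    [atan] is what makes the kernel integrable. *)
Lemma kernel_le_cauchy (alpha : R) (n : nat) (x : R) :
  (1 <= n)%nat -> kernel alpha n x <= / (1 + x²).
Proof.
  intros hn. unfold kernel, Rsqr.
  assert (Hn : 1 <= INR n) by (change 1 with (INR 1); now apply le_INR).
  apply Rinv_le_contravar; [nra|].
  apply Rle_trans with (Rpower (1 + alpha ^ 2 + x ^ 2) 1).
  - rewrite Rpower_1; nra.
  - apply Rle_Rpower; nra.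
Qed.

(** The common exponent is positive, so it suffices to compare the bases. With [A = 1 + alpha ^ 2],
    the difference of their products is [A (r ^ 2 - 1) (t ^ 2 - x ^ 2)], which is positive. *)
Lemma kernel_ratio_increasing (alpha : R) (n : nat) (r t x : R) :
  1 < r -> t < x <= 0 ->
  kernel alpha n x * kernel alpha n (r * t)
    < kernel alpha n (r * x) * kernel alpha n t.
Proof.
  intros Hr Htx. unfold kernel.
  assert (Hn := pos_INR n).
  rewrite <- !Rinv_mult, !Rpower_mult_distr by nra.
  apply Rinv_lt_contravar; [apply Rmult_lt_0_compat; apply exp_pos|].
  apply Rlt_Rpower_l; [lra|]. split; [apply Rmult_lt_0_compat; nra|].
  assert (H1 : 0 < (r - 1) * (r + 1)) by (apply Rmult_lt_0_compat; lra).
  assert (H2 : 0 < (x - t) * (- x - t)) by (apply Rmult_lt_0_compat; lra).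
  assert (H3 : 0 < (1 + alpha ^ 2) * ((r - 1) * (r + 1) * ((x - t) * (- x - t)))).
  { apply Rmult_lt_0_compat; [nra|]. now apply Rmult_lt_0_compat. }
  nra.
Qed.

(** The reflection equation records both the evenness of [k] and its total mass: letting [x] tend to
    infinity shows that [Phi] tends to [m]. *)
Definition cumulative (k Phi : R -> R) (m : R) : Prop :=
  (forall x, is_derive Phi x (k x)) /\ is_lim Phi m_infty 0 /\
  (forall x, Phi x + Phi (- x) = m).

Lemma ex_cumulative_kernel (alpha : R) (n : nat) (hn : (1 <= n)%nat) :
  exists Phi m, cumulative (kernel alpha n) Phi m.
Proof.
  set (k := kernel alpha n).
  set (P := fun x => RInt k 0 x).
  assert (dP : forall x, is_derive P x (k x)).
  { intros x. apply is_derive_RInt with 0.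
    - apply filter_forall. intros y. apply RInt_correct, ex_RInt_continuous.
      intros z _. apply kernel_continuous.
    - apply kernel_continuous. }
  assert (P0 : P 0 = 0) by exact (RInt_point 0 k).
  destruct (nondecreasing_lim_m_infty P (- (PI / 2))) as [l Hl].
  - intros x y [Hxy| ->]; [|lra].
    apply Rlt_le, (derive_pos_increasing P k dP); [apply kernel_pos|easy].
  - intros x Hx.
    destruct Hx as [Hx| ->]; [|assert (H := PI_RGT_0); lra].
    (* The function [P - atan] vanishes at 0 and is nonincreasing, so [P x >= atan x > - PI / 2] for
       negative [x]. *)
    destruct (MVT_cor2 (fun t => P t - atan t) (fun t => k t - / (1 + t²)) x 0 Hx)
      as [c [Hc _]].
    + intros t _. apply is_derive_Reals.
      apply (is_derive_minus P atan); [apply dP|apply is_derive_atan].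
    + rewrite P0, atan_0 in Hc.
      assert (H := kernel_le_cauchy alpha n c hn). fold k in H.
      assert (Ha := atan_bound x). nra.
  - exists (fun x => P x - l), (- 2 * l). split; [|split].
    + intros x. replace (k x) with (k x - 0) by ring.
      apply (is_derive_minus P (fun _ => l)); [apply dP|apply @is_derive_const].
    + replace (Finite 0) with (Finite (l - l)) by (f_equal; ring).
      apply (is_lim_minus' P (fun _ => l)); [exact Hl|apply is_lim_const].
    + intros x.
      (* [P] is odd: [P t + P (- t)] vanishes at 0 and has zero derivative, since [k] is even. This
         gives the total mass [- 2 * l]. *)
      assert (dodd : forall t, is_derive (fun t => P t + P (- t)) t (k t + - k (- t))).
      { intros t. apply (is_derive_plus P (fun t => P (- t))); [apply dP|].
        replace (- k (- t)) with (scal (- 1) (k (- t))) by (unfold scal; simpl; unfold mult; simpl; ring).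
        apply (is_derive_comp P Ropp); [apply dP|].
        auto_derive; [easy|ring]. }
      destruct (MVT_gen (fun t => P t + P (- t)) 0 x (fun t => k t + - k (- t)))
        as [c [_ Hc]].
      * intros t _. apply dodd.
      * intros t _. apply continuity_pt_filterlim.
        apply (ex_derive_continuous (fun t => P t + P (- t))). eexists. apply dodd.
      * unfold k at 1 2 in Hc. rewrite kernel_even, Ropp_0, P0 in Hc. lra.
Qed.

(** * Distribution functions of a positive continuous even density *)

Section Cumulative.

Context (k Phi : R -> R) (m : R) (k_pos : forall x, 0 < k x)
  (k_cont : forall x, continuous k x) (cumul : cumulative k Phi m).

Lemma cumulative_increasing (x y : R) : x < y -> Phi x < Phi y.
Proof. apply (derive_pos_increasing Phi k); [apply cumul|apply k_pos]. Qed.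

Lemma cumulative_le_reg (x y : R) : Phi x <= Phi y -> x <= y.
Proof.
  intros H. destruct (Rle_dec x y) as [|Hn]; [easy|].
  assert (H1 := cumulative_increasing y x ltac:(lra)). lra.
Qed.

Lemma cumulative_pos (x : R) : 0 < Phi x.
Proof.
  destruct cumul as [_ [Hl _]].
  (* Passing to the limit gives only a weak inequality; the detour through [x - 1] makes it
     strict. *)
  apply Rle_lt_trans with (Phi (x - 1)); [|apply cumulative_increasing; lra].
  apply (is_lim_le_loc Phi (fun _ => Phi (x - 1)) m_infty 0 (Phi (x - 1)));
    [|exact Hl|apply is_lim_const].
  exists (x - 1). intros y Hy. now apply Rlt_le, cumulative_increasing.
Qed.

Lemma cumulative_lim_p_infty : is_lim Phi p_infty m.
Proof.
  destruct cumul as [_ [Hl Hs]].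
  apply is_lim_ext with (fun x => m - Phi (- x)).
  { intros x. specialize (Hs x). lra. }
  replace (Finite m) with (Finite (m - 0)) by (f_equal; ring).
  apply (is_lim_minus' (fun _ => m) (fun x => Phi (- x))); [apply is_lim_const|].
  apply (is_lim_comp Phi Ropp p_infty 0 m_infty); [exact Hl| |].
  - apply (is_lim_opp (fun x => x) p_infty p_infty), is_lim_id.
  - exists 0. easy.
Qed.

Lemma cumulative_surjective (y : R) : 0 < y < m -> exists x, Phi x = y.
Proof.
  intros Hy.
  destruct (IVT_Rbar_incr Phi m_infty p_infty 0 m y) as [x [_ [_ Hx]]];
    [apply cumul|apply cumulative_lim_p_infty| |easy|easy|now exists x].
  intros x _ _. apply continuity_pt_filterlim.
  apply (ex_derive_continuous Phi). eexists. apply cumul.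
Qed.

(** The upper filter is left general so as to cover both the whole line, for the normalizing
    constant, and a finite endpoint, for [g]. *)
Lemma is_RInt_gen_cumulative (C : R) (Fb : (R -> Prop) -> Prop) {FFb : Filter Fb} (l : R) :
  filterlim Phi Fb (locally l) ->
  is_RInt_gen (fun x => C * k x) (Rbar_locally m_infty) Fb (C * l).
Proof.
  intros Hl. destruct cumul as [dPhi [Hm _]].
  apply (is_RInt_gen_scal k C l).
  apply is_RInt_gen_ext with (Derive Phi).
  { apply filter_forall. intros ab x _. now apply is_derive_unique. }
  replace l with (l - 0) by ring.
  apply is_RInt_gen_Derive; [| |exact Hm|exact Hl].
  - apply filter_forall. intros ab x _. eexists. apply dPhi.
  - apply filter_forall. intros ab x _.
    apply continuous_ext with k; [|apply k_cont].
    intros t. symmetry. now apply is_derive_unique.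
Qed.

Lemma RInt_cumulative (C a b : R) :
  RInt (fun x => C * k x) a b = C * (Phi b - Phi a).
Proof.
  apply is_RInt_unique, (is_RInt_scal k a b C (Phi b - Phi a)).
  apply (is_RInt_derive Phi k); intros x _; [apply cumul|apply k_cont].
Qed.

(** * Dilation by a factor greater than 1 *)

Context (r : R) (Hr : 1 < r) (k_ratio : forall t x, t < x <= 0 ->
  k x * k (r * t) < k (r * x) * k t).

(** Monotone form of l'Hôpital's rule: the increments of [Phi (r t)] and [Phi t] have ratio at most
    [r k (r x) / k x] over the half-line left of [x], and a larger ratio over the interval from [x]
    to [w]. The function [H] keeps this slope at [x] fixed, so that [dH] is negative left of [x] and
    positive between [x] and [w]. *)
Lemma cumulative_ratio_increasing (x w : R) :
  x < w <= 0 -> Phi (r * x) * Phi w < Phi (r * w) * Phi x.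
Proof.
  intros Hxw. destruct cumul as [dPhi [Hm _]].
  set (H := fun t => k x * Phi (r * t) - r * k (r * x) * Phi t).
  set (dH := fun t => r * (k x * k (r * t) - k (r * x) * k t)).
  assert (HdH : forall t, is_derive H t (dH t)).
  { intros t. unfold H, dH. auto_derive.
    - repeat split; eexists; apply dPhi.
    - rewrite !(is_derive_unique _ _ _ (dPhi _)). ring. }
  (* [H] decreases up to [x] from its limit 0 at minus infinity. *)
  assert (Hleft : H x <= 0).
  { apply (is_lim_le_loc (fun _ => H x) H m_infty (H x) 0); [|apply is_lim_const|].
    - exists x. intros t Ht.
      destruct (MVT_cor2 H dH t x Ht) as [c [Hc Hcx]].
      + intros c _. apply is_derive_Reals, HdH.
      + specialize (k_ratio c x ltac:(lra)).
        assert (dH c < 0) by (unfold dH; nra). nra.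
    - replace (Finite 0) with (Finite (k x * 0 - r * k (r * x) * 0)) by (f_equal; ring).
      apply is_lim_minus'.
      + apply (is_lim_scal_l (fun t => Phi (r * t)) (k x) m_infty 0).
        apply (is_lim_comp Phi (fun t => r * t) m_infty 0 m_infty Hm).
        * replace m_infty with (Rbar_mult r m_infty) at 2.
          -- apply (is_lim_scal_l (fun t => t) r m_infty m_infty), is_lim_id.
          -- apply is_Rbar_mult_unique, is_Rbar_mult_sym, is_Rbar_mult_m_infty_pos. simpl; lra.
        * exists 0. easy.
      + apply (is_lim_scal_l Phi (r * k (r * x)) m_infty 0 Hm). }
  assert (Hright : H x < H w).
  { destruct (MVT_cor2 H dH x w (proj1 Hxw)) as [c [Hc Hcx]].
    - intros c _. apply is_derive_Reals, HdH.
    - specialize (k_ratio x c ltac:(lra)).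
      assert (0 < dH c) by (unfold dH; nra). nra. }
  unfold H in Hleft, Hright.
  assert (Hx := cumulative_pos x).
  assert (Hw := cumulative_increasing x w ltac:(lra)).
  (* Add [H x < H w] multiplied by [Phi x] to [H x <= 0] multiplied by [Phi w - Phi x]; the terms in
     [k (r * x)] cancel. *)
  apply Rmult_lt_reg_l with (k x); [apply k_pos|]. nra.
Qed.

(** Both summands are positive, so [x] and [y] lie left of [w]. Adding the two ratio inequalities
    bounds the left side times [Phi w] by [Phi (r * w) * (Phi x + Phi y)], and the last factor is
    [Phi w]. *)
Lemma cumulative_superadditive (x y w : R) :
  Phi x + Phi y = Phi w -> w <= 0 -> Phi (r * x) + Phi (r * y) < Phi (r * w).
Proof.
  intros Hxyw Hw.
  assert (Hx := cumulative_pos x). assert (Hy := cumulative_pos y).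
  assert (Hlt : forall t, Phi t < Phi w -> t < w <= 0).
  { intros t Ht. destruct (Rle_dec w t) as [H|H]; [|lra].
    destruct H as [H| ->]; [apply cumulative_increasing in H|]; lra. }
  assert (H1 := cumulative_ratio_increasing x w (Hlt x ltac:(lra))).
  assert (H2 := cumulative_ratio_increasing y w (Hlt y ltac:(lra))).
  apply Rmult_lt_reg_r with (Phi w); [lra|].
  rewrite <- Hxyw at 2. lra.
Qed.

Lemma cumulative_dilation (x y w : R) :
  Phi x + Phi y + Phi w = m -> Phi (r * x) + Phi (r * y) + Phi (r * w) < m.
Proof.
  destruct cumul as [_ [_ Hsym]].
  assert (Hnonneg : forall x y w, 0 <= w -> Phi x + Phi y + Phi w = m ->
            Phi (r * x) + Phi (r * y) + Phi (r * w) < m).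
  { clear x y w. intros x y w Hw Hsum.
    (* Reflecting [w] and [r * w] turns the claim into superadditivity at [- w <= 0]. *)
    assert (Hs := Hsym w). assert (Hrs := Hsym (r * w)).
    assert (H := cumulative_superadditive x y (- w) ltac:(lra) ltac:(lra)).
    replace (r * - w) with (- (r * w)) in H by ring. lra. }
  intros Hsum.
  destruct (Rle_lt_dec 0 w) as [Hw|Hw]; [now apply Hnonneg|].
  destruct (Rle_lt_dec 0 y) as [Hy|Hy].
  { assert (H := Hnonneg x w y Hy ltac:(lra)). lra. }
  destruct (Rle_lt_dec 0 x) as [Hx|Hx].
  { assert (H := Hnonneg w y x Hx ltac:(lra)). lra. }
  (* All three points are negative, so dilation moves each of them to the left. *)
  rewrite <- Hsum.
  repeat apply Rplus_lt_compat; apply cumulative_increasing; nra.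
Qed.

Lemma cumulative_quantile_dilation (a b z z' : R) :
  Phi z = Phi b - Phi a -> Phi z' = Phi (r * b) - Phi (r * a) -> r * z < z'.
Proof.
  intros Hz Hz'. destruct cumul as [_ [_ Hsym]].
  apply Rnot_le_lt. intros Hle.
  assert (Hlt : Phi (r * z) < Phi z').
  { assert (Hb := Hsym b). assert (Hrb := Hsym (r * b)).
    assert (H := cumulative_dilation a (- b) z ltac:(lra)).
    replace (r * - b) with (- (r * b)) in H by ring. lra. }
  destruct Hle as [Hle| ->]; [apply cumulative_increasing in Hle|]; lra.
Qed.

End Cumulative.

(** * The normalizing constant and the quantile [g] *)

Lemma norm_const_pos (alpha : R) (n : nat) (hn : (1 <= n)%nat) :
  0 < norm_const alpha n.
Proof.
  destruct (ex_cumulative_kernel alpha n hn) as [Phi [m cumul]].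
  assert (Hpos := kernel_pos alpha n). assert (Hcont := kernel_continuous alpha n).
  assert (Hm : 0 < m).
  { assert (Hsym := proj2 (proj2 cumul)). rewrite <- (Hsym 0), Ropp_0.
    assert (H := cumulative_pos _ Phi m Hpos cumul 0). lra. }
  assert (Htotal : forall c, is_RInt_gen (fun x => c * kernel alpha n x)
      (Rbar_locally m_infty) (Rbar_locally p_infty) (c * m)).
  { intros c. apply (is_RInt_gen_cumulative _ Phi m Hcont cumul); [typeclasses eauto|].
    exact (cumulative_lim_p_infty _ Phi m cumul). }
  refine (proj1 (iota_correct (fun c : R => 0 < c /\
    is_RInt_gen (fun x => c * kernel alpha n x)
      (Rbar_locally m_infty) (Rbar_locally p_infty) 1) _)).
  (* [iota] satisfies its predicate once existence and uniqueness are shown; the constant is the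
     inverse of the total mass. *)
  exists (/ m). split.
  - split; [now apply Rinv_0_lt_compat|].
    rewrite <- (Rinv_l m) by lra. apply Htotal.
  - intros c [_ Hc].
    assert (Hcm := is_RInt_gen_inj _ _ _ _ _ Hc (Htotal c)).
    apply Rmult_eq_reg_r with m; [|lra]. rewrite <- Hcm. now apply Rinv_l, Rgt_not_eq.
Qed.

(** The positive normalizing constant cancels from both integrals. The remaining equation has a
    solution by the intermediate value theorem, and only one because [Phi] is strictly
    increasing. *)
Lemma g_spec (alpha : R) (n : nat) (hn : (1 <= n)%nat) (Phi : R -> R) (m a b : R) :
  cumulative (kernel alpha n) Phi m -> a < b ->
  Phi (g alpha n a b) = Phi b - Phi a.
Proof.
  intros cumul Hab.
  assert (Hpos := kernel_pos alpha n). assert (Hcont := kernel_continuous alpha n).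
  assert (HC := norm_const_pos alpha n hn). set (C := norm_const alpha n) in *.
  assert (Hmass : forall z, is_RInt_gen (Defs.f alpha n) (Rbar_locally m_infty)
                              (at_point z) (C * Phi z)).
  { intros z. apply (is_RInt_gen_cumulative _ Phi m Hcont cumul); [typeclasses eauto|].
    intros Q HQ. exact (locally_singleton (Phi z) Q HQ). }
  assert (Hint : RInt (Defs.f alpha n) a b = C * (Phi b - Phi a))
    by exact (RInt_cumulative _ Phi m Hcont cumul C a b).
  assert (Hiff : forall z, is_RInt_gen (Defs.f alpha n) (Rbar_locally m_infty)
      (at_point z) (RInt (Defs.f alpha n) a b) <-> Phi z = Phi b - Phi a).
  { intros z. rewrite Hint. split.
    - intros H. apply (is_RInt_gen_inj _ _ _ _ _ (Hmass z)) in H.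
      apply Rmult_eq_reg_l with C; lra.
    - intros <-. apply Hmass. }
  apply Hiff. unfold g.
  apply (iota_correct (fun z : R => is_RInt_gen (Defs.f alpha n)
    (Rbar_locally m_infty) (at_point z) (RInt (Defs.f alpha n) a b))).
  destruct (cumulative_surjective _ Phi m cumul (Phi b - Phi a)) as [z Hz].
  (* The target lies strictly between 0 and [m]: [Phi b - Phi a < Phi b = m - Phi (- b) < m]. *)
  { assert (H1 := cumulative_increasing _ Phi m Hpos cumul a b Hab).
    assert (H2 := cumulative_pos _ Phi m Hpos cumul a).
    assert (H3 := cumulative_pos _ Phi m Hpos cumul (- b)).
    assert (H4 := proj2 (proj2 cumul) b). lra. }
  exists z. split; [now apply Hiff|].
  intros y Hy. apply Hiff in Hy.
  apply Rle_antisym; apply (cumulative_le_reg _ Phi m Hpos cumul); lra.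
Qed.

Lemma g_dilation_lt (alpha : R) (n : nat) (hn : (1 <= n)%nat) (a b r : R) :
  a < b -> 1 < r -> r * g alpha n a b < g alpha n (r * a) (r * b).
Proof.
  intros Hab Hr.
  destruct (ex_cumulative_kernel alpha n hn) as [Phi [m cumul]].
  apply (cumulative_quantile_dilation _ Phi m (kernel_pos alpha n) cumul r Hr)
    with a b.
  - intros t x. now apply kernel_ratio_increasing.
  - now apply (g_spec alpha n hn Phi m).
  - apply (g_spec alpha n hn Phi m); [easy|nra].
Qed.

Theorem theorem9 (n : nat) (hn : (1 <= n)%nat) (a b alpha r : R)
  (hab : a < b) (halpha : 0 <= alpha) (hr : 0 < r) :
  g alpha n (r * a) (r * b) >= r * g alpha n a b <-> r >= 1.
Proof.
  split.
  - intros H. destruct (Rle_lt_dec 1 r) as [Hr|Hr]; [lra|exfalso].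
    assert (Hinv : 1 < / r) by (rewrite <- Rinv_1; apply Rinv_lt_contravar; lra).
    (* Dilating the interval from [r * a] to [r * b] by [/ r] gives back [a] and [b]; the strict
       inequality, multiplied by [r], contradicts [H]. *)
    assert (Hlt := g_dilation_lt alpha n hn (r * a) (r * b) (/ r) ltac:(nra) Hinv).
    rewrite <- !Rmult_assoc, Rinv_l, !Rmult_1_l in Hlt by lra.
    apply (Rmult_lt_compat_l r) in Hlt; [|easy].
    rewrite <- Rmult_assoc, Rinv_r in Hlt by lra. lra.
  - intros [Hr| ->].
    + now apply Rgt_ge, g_dilation_lt.
    + rewrite !Rmult_1_l. lra.
Qed.
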